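(* Let $m$ be a positive integer, let $g:\mathbb{R}^2\to[0,\infty)$ be measurable, and for real $a,b,c$ let $$h_{a,b,c}(\Psi,\nu)=K(a,b,c)\,g(\Psi,\nu)\,e^{\Psi a-b\nu}\,Z(\Psi,\nu)^{-c},\qquad (\Psi,\nu)\in\mathbb{R}^2,$$ where $Z(\Psi,\nu)=\sum_{k=0}^m e^{\Psi k}/[k!(m-k)!]^\nu$ and $$K(a,b,c)^{-1}=\int_{-\infty}^\infty\int_{-\infty}^\infty g(\Psi,\nu)e^{\Psi a-b\nu}Z(\Psi,\nu)^{-c}\,d\Psi\,d\nu .$$ Suppose $0<K(a,b,c)^{-1}<\infty$, so that $h_{a,b,c}$ is a probability density. If $(\Psi,\nu)$ has prior density $h_{a,b,c}$ and, conditionally on $(\Psi,\nu)$, a single observation $k\in\{0,1,\dots,m\}$ is drawn from the Conway-Maxwell-Binomial distribution with parameters $(\Psi,\nu)$, then the posterior density of $(\Psi,\nu)$ given $k$ is $h_{a',b',c'}$ with $$a'=a+k,\qquad b'=b+\log(k!(m-k)!),\qquad c'=c+1 .$$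
   Context: The Conway-Maxwell-Binomial distribution on $\{0,\dots,m\}$ with parameters $p\in(0,1)$, $\nu\in\mathbb{R}$ has mass function proportional in $k$ to $p^k(1-p)^{m-k}\binom{m}{k}^\nu$. In terms of $\Psi=\log(p/(1-p))$ its mass function is $$P(k\mid\Psi,\nu)=\frac{e^{\Psi k}}{[k!(m-k)!]^\nu}\Big/\sum_{j=0}^m\frac{e^{\Psi j}}{[j!(m-j)!]^\nu},\qquad k=0,1,\dots,m.$$ *)

(* Defs.v *)
From HB Require Import structures.
From mathcomp Require Import all_boot all_order all_algebra.
From mathcomp Require Import all_classical all_reals all_analysis.
Set Implicit Arguments.
Unset Strict Implicit.
Unset Printing Implicit Defensive.
Import Order.TTheory GRing.Theory Num.Theory.
Import numFieldNormedType.Exports.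
Local Open Scope classical_set_scope.
Local Open Scope ring_scope.

Section conway_maxwell_binomial.
Context {R : realType}.
Implicit Types (m k : nat) (psi nu : R).

(* k! (m - k)!, used for k <= m only (m - k is truncated) *)
Definition cmb_fact m k : R := (k`! * (m - k)`!)%:R.

Definition cmb_weight m psi nu k : R :=
  expR (psi * k%:R) / (cmb_fact m k) `^ nu.

Definition cmb_Z m psi nu : R := \sum_(0 <= k < m.+1) cmb_weight m psi nu k.

(* A mass function on nat, supported in {0, ..., m}. *)
Definition cmb_pmf m psi nu k : R :=
  if (k <= m)%N then cmb_weight m psi nu k / cmb_Z m psi nu else 0.

End conway_maxwell_binomial.

Section prior.
Context {R : realType} (m : nat) (g : R * R -> R).
Implicit Types a b c : R.

(* Points of R * R are pairs (psi, nu). *)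
Definition cmb_kernel a b c (t : R * R) : R :=
  g t * expR (t.1 * a - b * t.2) * (cmb_Z m t.1 t.2) `^ (- c).

(* The inner integral is in psi, the outer one in nu. *)
Definition cmb_Kinv a b c : \bar R :=
  (\int[lebesgue_measure]_nu \int[lebesgue_measure]_psi
     (cmb_kernel a b c (psi, nu))%:E)%E.

(* Meaningful only when 0 < cmb_Kinv a b c < +oo. *)
Definition cmb_K a b c : R := (fine (cmb_Kinv a b c))^-1.

Definition cmb_prior a b c (t : R * R) : R := cmb_K a b c * cmb_kernel a b c t.

End prior.

Section densities.
Context {R : realType}.

Definition is_density2 (Q : set (R * R) -> \bar R) (f : R * R -> R) : Prop :=
  [/\ measurable_fun [set: R * R] f,
      forall t, 0 <= f t &
      forall A : set (R * R), measurable A ->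
        Q A = (\int[lebesgue_measure \x lebesgue_measure]_(t in A) (f t)%:E)%E].

Context {d : measure_display} {T : measurableType d} (P : probability T R).

(* Elementary conditional probability, for events B with 0 < P B. *)
Definition cond_prob (A B : set T) : \bar R := (P (A `&` B) / P B)%E.

Context (Theta : {RV P >-> (R * R)%type}) (X : {RV P >-> nat}).

(* q t is a (version of the) conditional mass function of X given Theta = t. *)
Definition has_cond_pmf (q : R * R -> nat -> R) : Prop :=
  forall (A : set (R * R)) (j : nat), measurable A ->
    P (Theta @^-1` A `&` X @^-1` [set j]) =
    (\int[distribution P Theta]_(t in A) (q t j)%:E)%E.

(* The event X = k must have positive probability, so that conditioning on it
   is elementary. *)
Definition is_posterior_density (k : nat) (f : R * R -> R) : Prop :=
  (0 < P (X @^-1` [set k]))%E /\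
  is_density2 (fun A => cond_prob (Theta @^-1` A) (X @^-1` [set k])) f.

End densities.

(* Main.v *)
Require Import Defs.
From mathcomp Require Import all_boot all_order all_algebra.
From mathcomp Require Import all_classical all_reals all_analysis.
From mathcomp Require Import measurable_realfun ring.
Import Order.TTheory GRing.Theory Num.Theory.
Import numFieldNormedType.Exports.
Local Open Scope classical_set_scope.
Local Open Scope ring_scope.

(* The new kernel is the old one times the likelihood:
   [cmb_kernel a' b' c' t = cmb_pmf k t * cmb_kernel a b c t], because
   [(k! (m - k)!)^(-nu) = exp (- ln (k! (m - k)!) * nu)].  Hence the joint law is
   [P (Theta in A, X = k) = K \int_A cmb_kernel a' b' c'], and dividing by its
   value [K / K'] at the whole plane gives the density [K' cmb_kernel a' b' c'].
   The new normalizing integral is finite because the likelihood is at most 1,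
   and nonzero because the likelihood is positive. *)

(** * Integration against a measure given by a density *)

Section integral_density.
Local Open Scope ereal_scope.
Import HBNNSimple.
Context d (T : measurableType d) (R : realType).
Variables (mu Q : {measure set T -> \bar R}) (f : T -> R).
Hypotheses (mf : measurable_fun [set: T] f) (f0 : forall x, (0 <= f x)%R).
Hypothesis Qf : forall A, measurable A -> Q A = \int[mu]_(x in A) (f x)%:E.
Variables (D : set T) (mD : measurable D).

Let integral_density_indic E : measurable E ->
  \int[Q]_(x in D) (\1_E x)%:E = \int[mu]_(x in D) ((\1_E x)%:E * (f x)%:E).
Proof.
move=> mE; rewrite integral_indic// setIC Qf; last exact: measurableI.
rewrite integral_mkcondr; apply: eq_integral => x _.
by rewrite epatch_indic/= muleC.
Qed.

Let measurable_indicM (E : set T) : measurable E ->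
  measurable_fun D (fun x => (\1_E x)%:E * (f x)%:E).
Proof.
by move=> mE; apply: emeasurable_funM; exact/measurable_EFinP/measurable_funTS.
Qed.

Let measurable_nnsfunM (h : {nnsfun T >-> R}) :
  measurable_fun D (fun x => (h x)%:E * (f x)%:E).
Proof. by apply: emeasurable_funM; exact/measurable_EFinP/measurable_funTS. Qed.

Let integral_density_nnsfun (h : {nnsfun T >-> R}) :
  \int[Q]_(x in D) (h x)%:E = \int[mu]_(x in D) ((h x)%:E * (f x)%:E).
Proof.
under [LHS]eq_integral do rewrite fimfunE -fsumEFin//.
rewrite [LHS]ge0_integral_fsum//; last 2 first.
  - by move=> r; exact/measurable_EFinP/measurableT_comp.
  - by move=> n x _; rewrite EFinM nnfun_muleindic_ge0.
under [RHS]eq_integral.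
  move=> x xD; rewrite fimfunE -fsumEFin// ge0_mule_fsuml; last first.
    by move=> r; rewrite EFinM nnfun_muleindic_ge0.
  over.
rewrite [RHS]ge0_integral_fsum//; last 2 first.
  - move=> r; apply: emeasurable_funM.
      exact/measurable_EFinP/measurableT_comp.
    exact/measurable_EFinP/measurable_funTS.
  - move=> n x _; apply: mule_ge0; last by rewrite lee_fin.
    by rewrite EFinM nnfun_muleindic_ge0.
(* The sum runs over the range of [h], so each coefficient is some [h y >= 0] and may be pulled out
   of both integrals. *)
apply: eq_fsbigr => _ /[!inE] -[y _ <-].
rewrite integralZl_indic_nnsfun// integral_density_indic//.
rewrite -ge0_integralZl//.
- by apply: eq_integral => x _; rewrite EFinM muleA.
- exact: measurable_indicM.
- by move=> x _; rewrite mule_ge0// lee_fin.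
- by rewrite lee_fin.
Qed.

(** Change of measure [dQ = f dmu]: the hypothesis on [Q] is the case of indicators, linearity gives
    simple functions, and monotone convergence along [nnsfun_approx] gives the rest; [f >= 0] keeps
    the products with [f] increasing. *)
Lemma ge0_integral_density (q : T -> \bar R) : measurable_fun D q ->
    (forall x, D x -> 0 <= q x) ->
  \int[Q]_(x in D) q x = \int[mu]_(x in D) (q x * (f x)%:E).
Proof.
move=> mq q0; pose q_ := nnsfun_approx mD mq.
transitivity (limn (fun n => \int[Q]_(x in D) (q_ n x)%:E)).
  rewrite -monotone_convergence//=.
  - apply: eq_integral => x /[!inE] xD; apply/esym/cvg_lim => //=.
    exact: cvg_nnsfun_approx.
  - by move=> n; exact/measurable_EFinP/measurable_funTS.
  - by move=> n x _; rewrite lee_fin.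
  - by move=> x _ i j ij; rewrite lee_fin; exact/lefP/nd_nnsfun_approx.
under eq_fun do rewrite integral_density_nnsfun.
rewrite -monotone_convergence//=.
- apply: eq_integral => x /[!inE] xD; apply/cvg_lim => //=.
  by apply: cvgeZr => //; exact: cvg_nnsfun_approx.
- by move=> n x _; rewrite mule_ge0// lee_fin.
- move=> x _ i j ij; apply: lee_wpmul2r; rewrite lee_fin//.
  exact/lefP/nd_nnsfun_approx.
Qed.

End integral_density.
Arguments ge0_integral_density {d T R mu Q f} _ _ _ {D}.

(** If the integral of [p * f] vanished, [p * f] would be null almost everywhere, hence so would
    [f], since [p] has no zero. Applied with [p] the likelihood and [f] the old kernel. *)
Lemma integral_pmul_gt0 d (T : measurableType d) (R : realType)
    (mu : {measure set T -> \bar R}) (p f : T -> R) :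
    measurable_fun [set: T] p -> measurable_fun [set: T] f ->
    (forall x, 0 < p x) -> (forall x, 0 <= f x) ->
  (0 < \int[mu]_x (f x)%:E -> 0 < \int[mu]_x (p x * f x)%:E)%E.
Proof.
move=> mp mf p0 f0 If.
have pf0 x : 0 <= p x * f x by rewrite mulr_ge0// ltW.
rewrite lt0e integral_ge0; last by move=> x _; rewrite lee_fin.
rewrite andbT; apply/eqP => Ipf; move: If; rewrite ltNge => /negP; apply.
have {}Ipf : (\int[mu]_x `|(p x * f x)%:E| = 0)%E.
  by rewrite -[RHS]Ipf; apply: eq_integral => x _; rewrite gee0_abs ?lee_fin.
move/(ae_eq_integral_abs _ measurableT) in Ipf.
have /Ipf pf_ae : measurable_fun [set: T] (fun x => (p x * f x)%:E).
  exact/measurable_EFinP/measurable_funM.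
rewrite (@ge0_ae_eq_integral _ _ _ mu _ _ (cst 0%E) measurableT)//.
- by rewrite integral0.
- exact/measurable_EFinP.
- by move=> x _; rewrite lee_fin.
- apply: filterS pf_ae => x /= /(_ I) [] /eqP.
  by rewrite mulf_eq0 (gt_eqF (p0 x)) => /eqP ->.
Qed.

(** The prior constant [K] is common to the joint probability and the marginal of [X], so it cancels
    in Bayes' formula; the bounds on [Z] turn extended division into a real inverse. *)
Lemma mule_divK_fine (R : realType) (K : R) (Z J : \bar R) :
    0 < K -> (0 < Z < +oo)%E ->
  (K%:E * J / (K%:E * Z) = ((fine Z)^-1)%:E * J)%E.
Proof.
move=> K0; case: Z => [z| |]; rewrite ?ltxx ?andbF// => /andP[z0 _].
rewrite lte_fin in z0; rewrite -EFinM inver mulf_eq0 !gt_eqF//=.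
by rewrite muleAC -EFinM invfM mulrA mulfV ?mul1r// gt_eqF.
Qed.

(** * Positivity and bounds of the likelihood, and the kernel update *)

Section conway_maxwell_binomial.
Context {R : realType}.
Implicit Types (m k : nat) (a b c psi nu : R) (g : R * R -> R).

Lemma cmb_fact_gt0 m k : 0 < cmb_fact m k :> R.
Proof. by rewrite ltr0n muln_gt0 !fact_gt0. Qed.

Lemma cmb_weight_gt0 m psi nu k : 0 < cmb_weight m psi nu k.
Proof. by rewrite divr_gt0 ?expR_gt0// powR_gt0// cmb_fact_gt0. Qed.

Lemma cmb_weight_le_Z m psi nu k : (k <= m)%N ->
  cmb_weight m psi nu k <= cmb_Z m psi nu.
Proof.
move=> km; rewrite /cmb_Z big_mkord (bigD1 (Ordinal (km : (k < m.+1)%N)))//=.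
by rewrite lerDl sumr_ge0// => i _; exact/ltW/cmb_weight_gt0.
Qed.

Lemma cmb_Z_gt0 m psi nu : 0 < cmb_Z m psi nu.
Proof.
exact: lt_le_trans (cmb_weight_gt0 m psi nu 0) (cmb_weight_le_Z _ _ _ _ _).
Qed.

Lemma cmb_pmf_ge0 m psi nu k : 0 <= cmb_pmf m psi nu k.
Proof.
rewrite /cmb_pmf; case: ifP => // _.
by rewrite divr_ge0// ltW// ?cmb_weight_gt0 ?cmb_Z_gt0.
Qed.

Lemma cmb_pmf_gt0 m psi nu k : (k <= m)%N -> 0 < cmb_pmf m psi nu k.
Proof.
by move=> km; rewrite /cmb_pmf km divr_gt0 ?cmb_weight_gt0 ?cmb_Z_gt0.
Qed.

Lemma cmb_pmf_le1 m psi nu k : cmb_pmf m psi nu k <= 1.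
Proof.
rewrite /cmb_pmf; case: ifP => // km.
by rewrite ler_pdivrMr ?cmb_Z_gt0// mul1r cmb_weight_le_Z.
Qed.

Lemma cmb_kernel_update m g a b c k t : (k <= m)%N ->
  cmb_kernel m g (a + k%:R) (b + ln (cmb_fact m k)) (c + 1) t =
  cmb_pmf m t.1 t.2 k * cmb_kernel m g a b c t.
Proof.
case: t => psi nu km; rewrite /cmb_kernel /cmb_pmf km /cmb_weight /=.
have F0 := cmb_fact_gt0 m k; have Z0 := cmb_Z_gt0 m psi nu.
have -> : psi * (a + k%:R) - (b + ln (cmb_fact m k)) * nu =
    (psi * a - b * nu) + psi * k%:R + - nu * ln (cmb_fact m k).
  by ring.
(* The power law for a sum of exponents asks for a nonzero base when the sum is zero; [Z > 0]
   settles this. *)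
rewrite opprD powRD; last by rewrite (gt_eqF Z0) implybT.
rewrite powR_inv1 ?(ltW Z0)// !expRD -powRN.
rewrite -ln_powR lnK ?posrE ?powR_gt0//.
ring.
Qed.

Lemma cmb_kernel_ge0 m g a b c t : (forall t, 0 <= g t) ->
  0 <= cmb_kernel m g a b c t.
Proof. by move=> g0; rewrite !mulr_ge0 ?expR_ge0 ?powR_ge0. Qed.

(** * Measurability in the parameters, and the normalizing integral *)

Lemma measurable_cmb_weight m k :
  measurable_fun [set: R * R] (fun t => cmb_weight m t.1 t.2 k).
Proof.
rewrite /cmb_weight; under eq_fun do rewrite -powRN.
apply: measurable_funM.
  by apply: measurableT_comp => //; apply: measurable_funM.
apply: measurableT_comp; first exact: measurable_powRr.
exact: measurableT_comp.
Qed.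

Lemma measurable_cmb_Z m :
  measurable_fun [set: R * R] (fun t => cmb_Z m t.1 t.2).
Proof. by apply: measurable_sum => k; exact: measurable_cmb_weight. Qed.

Lemma measurable_cmb_pmf m k :
  measurable_fun [set: R * R] (fun t => cmb_pmf m t.1 t.2 k).
Proof.
rewrite /cmb_pmf; case: (k <= m)%N; last exact: measurable_cst.
(* Division by [Z] becomes the power [-1], to which measurability of real powers applies. *)
under eq_fun do rewrite -(powR_inv1 (ltW (cmb_Z_gt0 _ _ _))).
apply: measurable_funM; first exact: measurable_cmb_weight.
exact: (measurableT_comp (measurable_powR _) (measurable_cmb_Z m)).
Qed.

Lemma measurable_cmb_kernel m g a b c : measurable_fun [set: R * R] g ->
  measurable_fun [set: R * R] (cmb_kernel m g a b c).
Proof.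
move=> mg; apply: measurable_funM; last first.
  exact: (measurableT_comp (measurable_powR _) (measurable_cmb_Z m)).
apply: measurable_funM => //; apply: measurableT_comp => //.
by apply: measurable_funB; apply: measurable_funM.
Qed.

(* [lebesgue_measure] is a measure on [measurableTypeR R], an alias of [R] with
   the same measurable sets but another display: a measure on [R * R] proper is
   obtained by pushing the product measure forward along the identity. *)
Lemma integral_lebesgue2_borel :
  exists L : {measure set (R * R)%type -> \bar R},
  forall (A : set (R * R)) (f : R * R -> \bar R), measurable A ->
    measurable_fun A f -> (forall t, A t -> 0 <= f t)%E ->
    (\int[lebesgue_measure \x lebesgue_measure]_(t in A) f t =
     \int[L]_(t in A) f t)%E.
Proof.
pose mT : measurableType _ := (measurableTypeR R * measurableTypeR R)%type.
pose phi : mT -> R * R := id.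
have mphi : measurable_fun [set: mT] phi.
  exact: (@measurable_id _ (R * R)%type setT).
(* [pose] abstracts the measurability proof left open by the inference of the
   measure structure, so that [L] is a function of it. *)
pose L : {measure set (R * R)%type -> \bar R} :=
  pushforward (@lebesgue_measure R \x @lebesgue_measure R)%E phi.
exists (L mphi) => A f mA mf f0; apply/esym.
apply: (ge0_integral_pushforward mphi) => //.
by move=> t; rewrite inE; exact: f0.
Qed.

Lemma cmb_KinvE m g a b c : measurable_fun [set: R * R] g ->
  (forall t, 0 <= g t) ->
  cmb_Kinv m g a b c =
  (\int[lebesgue_measure \x lebesgue_measure]_t (cmb_kernel m g a b c t)%:E)%E.
Proof.
move=> mg g0.
have mker : measurable_fun [set: R * R] (fun t => (cmb_kernel m g a b c t)%:E).
  by apply/measurable_EFinP; exact: measurable_cmb_kernel.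
(* Tonelli in the order with the first coordinate [psi] innermost; nonnegativity suffices, so the
   integral may still be infinite. *)
rewrite fubini_tonelli2.
- reflexivity.
- exact mker.
- by move=> t; rewrite lee_fin cmb_kernel_ge0.
Qed.

Lemma cmb_K_gt0 m g a b c : (0 < cmb_Kinv m g a b c < +oo)%E ->
  0 < cmb_K m g a b c.
Proof. by move=> hK; rewrite invr_gt0; exact: fine_gt0. Qed.

End conway_maxwell_binomial.

Theorem mainTheorem4 (R : realType) (m : nat) (hm : (0 < m)%N)
    (g : R * R -> R) (mg : measurable_fun [set: R * R] g)
    (g0 : forall t, 0 <= g t) (a b c : R)
    (hK : (0 < cmb_Kinv m g a b c < +oo)%E)
    (d : measure_display) (T : measurableType d) (P : probability T R)
    (Theta : {RV P >-> (R * R)%type}) (X : {RV P >-> nat})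
    (hprior : is_density2 (distribution P Theta) (cmb_prior m g a b c))
    (hX : has_cond_pmf Theta X (fun t => cmb_pmf m t.1 t.2))
    (k : nat) (hk : (k <= m)%N) :
  let a' := a + k%:R in
  let b' := b + ln ((k`! * (m - k)`!)%:R : R) in
  let c' := c + 1 in
  (0 < cmb_Kinv m g a' b' c' < +oo)%E /\
  is_posterior_density Theta X k (cmb_prior m g a' b' c').
Proof.
move=> a' b' c'; have /andP[K0 Koo] := hK.
have [mprior prior_ge0 priorE] := hprior.
have kerE t : cmb_kernel m g a' b' c' t =
    cmb_pmf m t.1 t.2 k * cmb_kernel m g a b c t.
  exact: cmb_kernel_update.
(* From here on, the factorization [kerE] is all that is known of the new parameters. *)
clearbody a' b' c'.
have mker x y z := measurable_cmb_kernel m g x y z mg.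
have ker0 x y z t := cmb_kernel_ge0 m g x y z t g0.
have [L LE] := @integral_lebesgue2_borel R.
have {}LE A (f : R * R -> R) : measurable A -> measurable_fun [set: R * R] f ->
    (forall t, 0 <= f t) ->
    (\int[lebesgue_measure \x lebesgue_measure]_(t in A) (f t)%:E =
     \int[L]_(t in A) (f t)%:E)%E.
  move=> mA mf f0; apply: LE => //; last by move=> t _; rewrite lee_fin.
  exact/measurable_EFinP/measurable_funTS.
have KinvE x y z :
    cmb_Kinv m g x y z = (\int[L]_t (cmb_kernel m g x y z t)%:E)%E.
  by rewrite cmb_KinvE// LE//; exact: mker.
have hK' : (0 < cmb_Kinv m g a' b' c' < +oo)%E.
  rewrite !KinvE in K0 Koo *; apply/andP; split.
    under eq_integral do rewrite kerE.
    apply: integral_pmul_gt0 => //; first exact: measurable_cmb_pmf.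
    by move=> t; exact: cmb_pmf_gt0.
  apply: le_lt_trans Koo; apply: ge0_le_integral => //.
  - by move=> t _; rewrite lee_fin.
  - exact/measurable_EFinP.
  - exact/measurable_EFinP.
  - by move=> t _; rewrite lee_fin kerE ler_piMl// cmb_pmf_le1.
split=> //; have /andP[K'0 K'oo] := hK'.
have cK0 := cmb_K_gt0 _ _ _ _ _ hK; clear hK K0 Koo.
have cK'0 := cmb_K_gt0 _ _ _ _ _ hK'.
(* The law of [Theta] is restated against [L], so that both measures in [ge0_integral_density] live
   on [R * R] with one display. *)
have QE A : measurable A -> distribution P Theta A =
    (\int[L]_(t in A) (cmb_prior m g a b c t)%:E)%E.
  by move=> mA; rewrite priorE// LE.
have joint A : measurable A -> P (Theta @^-1` A `&` X @^-1` [set k]) =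
    ((cmb_K m g a b c)%:E *
     \int[L]_(t in A) (cmb_kernel m g a' b' c' t)%:E)%E.
  (* [hX] integrates the likelihood against the law of [Theta]; passing to [L] multiplies it by the
     prior density, and [kerE] merges it with the old kernel. *)
  move=> mA; rewrite hX// (ge0_integral_density mprior prior_ge0 QE)//.
  - rewrite -ge0_integralZl_EFin ?(ltW cK0)//.
    + by apply: eq_integral => t _; rewrite kerE !EFinM muleCA.
    + by move=> t _; rewrite lee_fin.
    + by apply/measurable_EFinP/measurable_funTS; exact: mker.
  - by apply/measurable_EFinP/measurable_funTS; exact: measurable_cmb_pmf.
  - by move=> t _; rewrite lee_fin cmb_pmf_ge0.
have PX : P (X @^-1` [set k]) =
    ((cmb_K m g a b c)%:E * cmb_Kinv m g a' b' c')%E.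
  by rewrite KinvE -joint// preimage_setT setTI.
split.
  by rewrite PX; apply: mule_gt0; [rewrite lte_fin; exact: cK0|exact: K'0].
have post_ge0 t : 0 <= cmb_prior m g a' b' c' t.
  exact: mulr_ge0 (ltW cK'0) (ker0 _ _ _ t).
have mpost : measurable_fun [set: R * R] (cmb_prior m g a' b' c').
  exact: measurable_funM.
split=> // A mA; rewrite /cond_prob joint// PX LE//.
under [RHS]eq_integral do rewrite EFinM.
rewrite ge0_integralZl_EFin; last 4 first.
- exact: mA.
- by move=> t _; rewrite lee_fin.
- by apply/measurable_EFinP/measurable_funTS; exact: mker.
- exact: (ltW cK'0).
(* The factor left after cancellation, [(fine (cmb_Kinv m g a' b' c'))^-1], is the new [cmb_K] by
   definition. *)
exact: mule_divK_fine.
Qed.
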